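(* For $k\geq 0$ let $P_k(q)=\dfrac{\Delta(q^{k+2})}{(k+2)!}$, $q\in\mathbb{H}$. Then $\{P_k\}_{k\ge 0}$ is an Appell set of spherical monogenics of degree $k$ in $\mathcal{RB}(\mathbb{H})$; that is, for every $k\ge 0$, $P_k$ is a Fueter regular polynomial of degree exactly $k$ belonging to $\mathcal{RB}(\mathbb{H})$, and for every $k\geq 1$ $$\tfrac12\,\overline{\partial}P_k=P_{k-1}.$$
   Context: $\mathbb{H}$ denotes the quaternions, $q=x_0+x_1i+x_2j+x_3k$; $\Delta=\sum_{l=0}^3\partial_{x_l}^2$ is the Laplacian on $\mathbb{R}^4\cong\mathbb{H}$. The Cauchy-Fueter operator is $\partial=\partial_{x_0}+i\partial_{x_1}+j\partial_{x_2}+k\partial_{x_3}$ and its conjugate is $\overline\partial=\partial_{x_0}-i\partial_{x_1}-j\partial_{x_2}-k\partial_{x_3}$ (acting from the left). A real differentiable function $f:\mathbb{H}\to\mathbb{H}$ is Fueter regular if $\partial f=0$ on $\mathbb{H}$. A spherical monogenic of degree $k$ is a Fueter regular polynomial of degree $k$ (polynomial in $x_0,\dots,x_3$ with quaternionic coefficients). $\mathcal{RB}(\mathbb{H})$ is the right $\mathbb{H}$-vector space of Fueter regular $f:\mathbb{H}\to\mathbb{H}$ with $\frac1{\pi^2}\int_{\mathbb{H}}|f(q)|^2e^{-|q|^2}d\lambda(q)<\infty$, $d\lambda$ being Lebesgue measure on $\mathbb{R}^4$. ''Appell set'' is meant with respect to the hypercomplex derivative $\frac12\overline\partial$, in the normalization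 ''derivative of $P_k$ equals $P_{k-1}$''. *)

(* Defs.v *)
From HB Require Import structures.
From mathcomp Require Import all_boot all_order all_algebra.
From mathcomp Require Import ring.
From mathcomp Require Import all_classical all_reals all_analysis.
(* The notations of mpoly clash with those of mathcomp-analysis. *)
From mathcomp Require Import -(notations) mpoly.
Import Order.TTheory GRing.Theory Num.Theory.
Import numFieldNormedType.Exports.

Set Implicit Arguments.
Unset Strict Implicit.
Unset Printing Implicit Defensive.

Local Open Scope ring_scope.

(* The quaternion x0 + x1 i + x2 j + x3 k is (x0, x1, x2, x3). The norm `|_|
   that comes with the normed module structure is the sup norm: it only serves
   to give the usual topology of R^4, hence the usual notions of differential
   and directional derivative. The Euclidean modulus is qabs below. *)
Definition quat (R : realType) : Type := (R * R * R * R)%type.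

HB.instance Definition _ (R : realType) :=
  NormedModule.on (quat R).

Section Quaternion.
Variable R : realType.
Implicit Types p q : quat R.

Definition Quat (a b c d : R) : quat R := (a, b, c, d).
Definition q0 q : R := q.1.1.1.
Definition q1 q : R := q.1.1.2.
Definition q2 q : R := q.1.2.
Definition q3 q : R := q.2.

Definition qone : quat R := Quat 1 0 0 0.
Definition qi : quat R := Quat 0 1 0 0.
Definition qj : quat R := Quat 0 0 1 0.
Definition qk : quat R := Quat 0 0 0 1.

Definition qmul p q : quat R :=
  Quat (q0 p * q0 q - q1 p * q1 q - q2 p * q2 q - q3 p * q3 q)
       (q0 p * q1 q + q1 p * q0 q + q2 p * q3 q - q3 p * q2 q)
       (q0 p * q2 q - q1 p * q3 q + q2 p * q0 q + q3 p * q1 q)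
       (q0 p * q3 q + q1 p * q2 q - q2 p * q1 q + q3 p * q0 q).

Lemma quat_eqP p q :
  q0 p = q0 q -> q1 p = q1 q -> q2 p = q2 q -> q3 p = q3 q -> p = q.
Proof.
by case: p q => [[[a b] c] d] [[[a' b'] c'] d'];
  rewrite /q0 /q1 /q2 /q3 /= => -> -> -> ->.
Qed.

Lemma q0D p q : q0 (p + q) = q0 p + q0 q. Proof. by []. Qed.
Lemma q1D p q : q1 (p + q) = q1 p + q1 q. Proof. by []. Qed.
Lemma q2D p q : q2 (p + q) = q2 p + q2 q. Proof. by []. Qed.
Lemma q3D p q : q3 (p + q) = q3 p + q3 q. Proof. by []. Qed.
Lemma q0Z (a : R) p : q0 (a *: p) = a * q0 p. Proof. by []. Qed.
Lemma q1Z (a : R) p : q1 (a *: p) = a * q1 p. Proof. by []. Qed.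
Lemma q2Z (a : R) p : q2 (a *: p) = a * q2 p. Proof. by []. Qed.
Lemma q3Z (a : R) p : q3 (a *: p) = a * q3 p. Proof. by []. Qed.
Definition qDZ := (q0D, q1D, q2D, q3D, q0Z, q1Z, q2Z, q3Z).

Lemma q0M p q : q0 (qmul p q) =
  q0 p * q0 q - q1 p * q1 q - q2 p * q2 q - q3 p * q3 q. Proof. by []. Qed.
Lemma q1M p q : q1 (qmul p q) =
  q0 p * q1 q + q1 p * q0 q + q2 p * q3 q - q3 p * q2 q. Proof. by []. Qed.
Lemma q2M p q : q2 (qmul p q) =
  q0 p * q2 q - q1 p * q3 q + q2 p * q0 q + q3 p * q1 q. Proof. by []. Qed.
Lemma q3M p q : q3 (qmul p q) =
  q0 p * q3 q + q1 p * q2 q - q2 p * q1 q + q3 p * q0 q. Proof. by []. Qed.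
Definition qcoordE := (qDZ, q0M, q1M, q2M, q3M).

Lemma qmulA : associative qmul.
Proof. by move=> p q r; apply: quat_eqP; rewrite !qcoordE; ring. Qed.

Lemma qmul1q : left_id qone qmul.
Proof.
by move=> p; apply: quat_eqP;
  rewrite !qcoordE /qone /Quat /q0 /q1 /q2 /q3 /=; ring.
Qed.

Lemma qmulq1 : right_id qone qmul.
Proof.
by move=> p; apply: quat_eqP;
  rewrite !qcoordE /qone /Quat /q0 /q1 /q2 /q3 /=; ring.
Qed.

Lemma qmulDl : left_distributive qmul +%R.
Proof. by move=> p q r; apply: quat_eqP; rewrite !qcoordE; ring. Qed.

Lemma qmulDr : right_distributive qmul +%R.
Proof. by move=> p q r; apply: quat_eqP; rewrite !qcoordE; ring. Qed.

Lemma qone_neq0 : qone != 0.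
Proof. by apply/eqP => /(congr1 q0) /eqP; rewrite oner_eq0. Qed.

Lemma qscaleAl (a : R) p q : a *: qmul p q = qmul (a *: p) q.
Proof. by apply: quat_eqP; rewrite !qcoordE; ring. Qed.

Lemma qscaleAr (a : R) p q : a *: qmul p q = qmul p (a *: q).
Proof. by apply: quat_eqP; rewrite !qcoordE; ring. Qed.

End Quaternion.

HB.instance Definition _ (R : realType) :=
  GRing.Zmodule_isNzRing.Build (quat R)
    (@qmulA R) (@qmul1q R) (@qmulq1 R) (@qmulDl R) (@qmulDr R) (@qone_neq0 R).
HB.instance Definition _ (R : realType) :=
  GRing.Lmodule_isLalgebra.Build R (quat R) (@qscaleAl R).
HB.instance Definition _ (R : realType) :=
  GRing.Lalgebra_isAlgebra.Build R (quat R) (@qscaleAr R).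

Section FueterRegular.
Variable R : realType.
Implicit Types (f : quat R -> quat R) (q : quat R).

Definition qabs q : R :=
  Num.sqrt (q0 q ^+ 2 + q1 q ^+ 2 + q2 q ^+ 2 + q3 q ^+ 2).

(* 'D_1, 'D_qi, 'D_qj, 'D_qk are the partial derivatives in x0, x1, x2, x3. *)
Definition laplacian f q : quat R :=
  'D_1 ('D_1 f) q + 'D_(qi R) ('D_(qi R) f) q
  + 'D_(qj R) ('D_(qj R) f) q + 'D_(qk R) ('D_(qk R) f) q.

Definition cauchy_fueter f q : quat R :=
  'D_1 f q + qi R * 'D_(qi R) f q + qj R * 'D_(qj R) f q
  + qk R * 'D_(qk R) f q.

Definition cauchy_fueter_conj f q : quat R :=
  'D_1 f q - qi R * 'D_(qi R) f q - qj R * 'D_(qj R) f q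
  - qk R * 'D_(qk R) f q.

Definition fueter_regular f : Prop :=
  (forall q, differentiable f q) /\ (forall q, cauchy_fueter f q = 0).

(* The real coordinates of q, embedded in the centre of the quaternions, so
   that evaluation at them does not depend on the side of the coefficients. *)
Definition coords q (l : 'I_4) : quat R :=
  (tnth [tuple q0 q; q1 q; q2 q; q3 q] l)%:A.

(* mpoly.msize is one plus the total degree, and zero for the polynomial 0. *)
Definition polynomial_of_degree (k : nat) f : Prop :=
  exists p : mpoly.mpoly 4 (quat R),
    mpoly.msize p = k.+1 /\ forall q, f q = mpoly.meval (coords q) p.

Definition spherical_monogenic (k : nat) f : Prop :=
  polynomial_of_degree k f /\ fueter_regular f.

Definition lebesgue4 :
    {measure set (measurableTypeR R * measurableTypeR R * measurableTypeR R
                  * measurableTypeR R)%type -> \bar R} :=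
  (((@lebesgue_measure R \x @lebesgue_measure R) \x @lebesgue_measure R)
     \x @lebesgue_measure R)%E.

Definition regular_Bargmann f : Prop :=
  fueter_regular f /\
  ((pi ^- 2)%:E *
     \int[lebesgue4]_q ((qabs (f q) ^+ 2 * expR (- (qabs q ^+ 2)))%:E)
   < +oo)%E.

Definition fueter_appell (k : nat) : quat R -> quat R :=
  fun q => (k.+2`!%:R^-1 : R) *: laplacian (fun x : quat R => x ^+ k.+2) q.

(* Appell property for the hypercomplex derivative (1/2) cauchy_fueter_conj. *)
Definition appell_set (P : nat -> quat R -> quat R) : Prop :=
  forall (k : nat) q, (1 <= k)%N ->
    (2^-1 : R) *: cauchy_fueter_conj (P k) q = P k.-1 q.

End FueterRegular.

Arguments fueter_appell R k : clear implicits.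

(* Main.v *)
From HB Require Import structures.
Require Import Defs.
From mathcomp Require Import all_boot all_order all_algebra.
From mathcomp Require Import ring lra.
From mathcomp Require Import all_classical all_reals all_analysis.
From mathcomp Require Import measurable_realfun.
From mathcomp Require Import -(notations) mpoly.
Import Order.TTheory GRing.Theory Num.Theory.
Import numFieldNormedType.Exports.

Set Implicit Arguments.
Unset Strict Implicit.
Unset Printing Implicit Defensive.

Local Open Scope ring_scope.

(** The Cauchy-Fueter operator and the Laplacian have constant coefficients, so
    they commute, and the Fueter regularity of [Delta (q^n)] amounts to the
    harmonicity of [G_n = partial (q^n)]. Writing [N = |q|^2], one has
    [q^2 = 2 x_0 q - N], hence [q^(n+2) = 2 x_0 q^(n+1) - N q^n]; the product
    rule turns this into [G_(n+2) = 2 x_0 G_(n+1) - N G_n], because the two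
    extra terms [2 q^(n+1)] and [- 2 q q^n] cancel ([dirac_hypervarX_rec]).
    Now [G_n] is homogeneous of degree [n - 1] and its derivative in [x_0] is
    [n G_(n-1)], since that of [q^n] is [n q^(n-1)]. These three facts make
    the Laplacian of [G_n] vanish by induction on [n] ([lapl_recurrence]); up to
    scaling, the [G_n] are the zonal harmonics of [R^4], i.e. the Gegenbauer
    polynomials [C^1_(n-1)].

    Once [partial P_k = 0] is known, the conjugate operator acts on [P_k] as
    twice the derivative in [x_0], which maps [q^(k+2) / (k+2)!] to
    [q^(k+1) / (k+1)!] and commutes with the Laplacian: this is the Appell
    property. It also shows that no [P_k] vanishes, because [P_0 = - 2]; being
    homogeneous of degree [k], [P_k] has degree exactly [k].

    All of this takes place among polynomials in four central variables with
    quaternionic coefficients; [ev_derive] identifies formal and analytic partial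
    derivatives of the associated functions. Finally a polynomial grows more
    slowly than [exp (|q|^2 / 4)], so the integrand of the Bargmann norm is
    bounded by a Gaussian, whose integral factors into one-dimensional ones. *)

(** * Constant coefficient operators on polynomials over a noncommutative ring *)

Section PolynomialOperators.
Variables (n : nat) (K : nzRingType) (e : 'I_n -> K).
Implicit Types (p f g : mpoly n K) (l m : 'I_n).

Definition var l : mpoly n K := mpolyX K (mnm1 l).
(** For the units [1, i, j, k] this is the Cauchy-Fueter operator. *)
Definition dirac_op p : mpoly n K := \sum_l e l *: mderiv l p.
Definition lapl p : mpoly n K := \sum_l mderiv l (mderiv l p).
Definition euler p : mpoly n K := \sum_l var l * mderiv l p.
(** For the units [1, i, j, k] this is the quaternionic variable itself. *)
Definition hypervar : mpoly n K := \sum_l e l *: var l.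
Definition sqnorm : mpoly n K := \sum_l var l ^+ 2.

Lemma varC l p : p * var l = var l * p.
Proof. exact: commr_mpolyX. Qed.

Lemma sqnormC p : p * sqnorm = sqnorm * p.
Proof.
rewrite mulr_sumr mulr_suml; apply: eq_bigr => l _.
by rewrite expr2 mulrA varC -mulrA varC mulrA.
Qed.

Lemma varZ l (c : K) p : c *: (var l * p) = var l * (c *: p).
Proof. by rewrite -!mul_mpolyC mulrA varC mulrA. Qed.

Lemma sqnormZ (c : K) p : c *: (sqnorm * p) = sqnorm * (c *: p).
Proof. by rewrite -!mul_mpolyC mulrA sqnormC mulrA. Qed.

Lemma mderiv_var l m : mderiv l (var m) = (l == m)%:R.
Proof.
rewrite mderivX mnm1E eq_sym; case: eqVneq => [->|_]; last by rewrite scale0r.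
have -> : mnm_sub (mnm1 m) (mnm1 m) = mnm0
  by apply/mnmP => i; rewrite !mnmE subnn.
by rewrite mpolyX0 scale1r.
Qed.

Lemma mderiv_sqnorm l : mderiv l sqnorm = var l *+ 2.
Proof.
rewrite /sqnorm raddf_sum (bigD1 l) //= big1 ?addr0 => [|m ml];
  rewrite expr2 mderivM mderiv_var.
  by rewrite eqxx mulr1 mul1r.
by rewrite eq_sym (negPf ml) mul0r mulr0 addr0.
Qed.

Lemma mderiv_hypervar l : mderiv l hypervar = (e l)%:A.
Proof.
rewrite /hypervar raddf_sum (bigD1 l) //= big1 ?addr0 => [|m ml];
  rewrite mderivZ mderiv_var ?eqxx //.
by rewrite eq_sym (negPf ml) scaler0.
Qed.

Lemma mderiv_dirac l p : mderiv l (dirac_op p) = dirac_op (mderiv l p).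
Proof.
rewrite /dirac_op raddf_sum; apply: eq_bigr => m _ /=.
by rewrite mderivZ mderiv_comm.
Qed.

Lemma mderiv_lapl l p : mderiv l (lapl p) = lapl (mderiv l p).
Proof.
rewrite /lapl raddf_sum; apply: eq_bigr => m _ /=.
by rewrite !(mderiv_comm l).
Qed.

Lemma dirac_is_additive : additive dirac_op.
Proof.
move=> p q; rewrite /dirac_op -sumrB; apply: eq_bigr => l _.
by rewrite mderivB scalerBr.
Qed.
HB.instance Definition _ := GRing.isAdditive.Build _ _ dirac_op dirac_is_additive.

Lemma lapl_is_additive : additive lapl.
Proof.
by move=> p q; rewrite /lapl -sumrB; apply: eq_bigr => l _; rewrite !mderivB.
Qed.
HB.instance Definition _ := GRing.isAdditive.Build _ _ lapl lapl_is_additive.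

Lemma euler_is_additive : additive euler.
Proof.
move=> p q; rewrite /euler -sumrB; apply: eq_bigr => l _.
by rewrite mderivB mulrBr.
Qed.
HB.instance Definition _ := GRing.isAdditive.Build _ _ euler euler_is_additive.

Lemma laplZ c p : lapl (c *: p) = c *: lapl p.
Proof. by rewrite scaler_sumr; apply: eq_bigr => l _; rewrite !mderivZ. Qed.

(** The coefficients [e l] stand on the left, so a scalar passes through the
    operator only when it commutes with them. *)
Lemma dirac_opZ c p : (forall l, GRing.comm c (e l)) ->
  dirac_op (c *: p) = c *: dirac_op p.
Proof.
move=> ce; rewrite /dirac_op scaler_sumr; apply: eq_bigr => l _.
by rewrite mderivZ !scalerA ce.
Qed.

Lemma dirac_lapl p : dirac_op (lapl p) = lapl (dirac_op p).
Proof.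
rewrite /dirac_op raddf_sum; apply: eq_bigr => l _.
by rewrite /= laplZ mderiv_lapl.
Qed.

Lemma dirac_var l p : dirac_op (var l * p) = e l *: p + var l * dirac_op p.
Proof.
rewrite /dirac_op mulr_sumr (eq_bigr (fun m => e m *: ((m == l)%:R * p)
  + var l * (e m *: mderiv m p))); last first.
  by move=> m _; rewrite mderivM mderiv_var scalerDr varZ.
rewrite big_split /= (bigD1 l) //= big1 ?addr0 ?eqxx ?mul1r // => m ml.
by rewrite (negPf ml) mul0r scaler0.
Qed.

(** The gradient of [|x|^2] is [2 x], and contracting it with the units
    rebuilds the variable [x] itself. *)
Lemma dirac_sqnorm p :
  dirac_op (sqnorm * p) = (hypervar * p) *+ 2 + sqnorm * dirac_op p.
Proof.
rewrite /dirac_op (eq_bigr (fun l => (e l *: var l * p) *+ 2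
  + sqnorm * (e l *: mderiv l p))); last first.
  move=> l _.
  by rewrite mderivM mderiv_sqnorm scalerDr sqnormZ mulrnAl -scalerMnr scalerAl.
by rewrite big_split /= sumrMnl -mulr_suml -mulr_sumr.
Qed.

Lemma lapl_var l p : lapl (var l * p) = mderiv l p *+ 2 + var l * lapl p.
Proof.
rewrite /lapl mulr_sumr (eq_bigr (fun m => ((m == l)%:R * mderiv m p) *+ 2
  + var l * mderiv m (mderiv m p))); last first.
  move=> m _; rewrite mderivM mderivD !mderivM mderiv_var.
  have -> : mderiv m (m == l)%:R = 0 :> mpoly n K.
    by rewrite -mpolyC_nat mderivC.
  by rewrite mul0r add0r addrA.
rewrite big_split /= (bigD1 l) //= big1 ?addr0 ?eqxx ?mul1r // => m ml.
by rewrite (negPf ml) mul0r mul0rn.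
Qed.

(** The cross term [2 grad |x|^2 . grad p] is four times the Euler operator. *)
Lemma lapl_sqnorm p :
  lapl (sqnorm * p) = p *+ n.*2 + euler p *+ 4 + sqnorm * lapl p.
Proof.
have -> : p *+ n.*2 = \sum_(l < n) p *+ 2.
  by rewrite sumr_const card_ord -mulrnA mul2n.
rewrite /lapl /euler -sumrMnl [sqnorm * \sum_(i < n) _]mulr_sumr -!big_split.
apply: eq_bigr => l _ /=.
rewrite mderivM mderivD !mderivM mderiv_sqnorm mderivMn mderiv_var eqxx.
by rewrite !mulrnAl mul1r !addrA.
Qed.

Lemma mderiv_euler l p : mderiv l (euler p) = mderiv l p + euler (mderiv l p).
Proof.
rewrite /euler raddf_sum (eq_bigr (fun m => (l == m)%:R * mderiv m p
  + var m * mderiv m (mderiv l p))); last first.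
  by move=> m _ /=; rewrite mderivM mderiv_var mderiv_comm.
rewrite big_split /= (bigD1 l) //= big1 ?addr0 ?eqxx ?mul1r // => m ml.
by rewrite eq_sym (negPf ml) mul0r.
Qed.

Lemma eulerZ c p : euler (c *: p) = c *: euler p.
Proof.
by rewrite /euler scaler_sumr; apply: eq_bigr => l _; rewrite mderivZ varZ.
Qed.

(** Differentiation lowers the Euler degree by one. *)
Lemma dirac_euler p : dirac_op (euler p) = dirac_op p + euler (dirac_op p).
Proof.
rewrite /dirac_op [in RHS]raddf_sum -big_split; apply: eq_bigr => l _ /=.
by rewrite mderiv_euler scalerDr eulerZ.
Qed.

Lemma eulerM p q : euler (p * q) = euler p * q + p * euler q.
Proof.
rewrite /euler mulr_suml mulr_sumr -big_split; apply: eq_bigr => l _ /=.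
by rewrite mderivM mulrDr !mulrA varC.
Qed.

Lemma euler_hypervar : euler hypervar = hypervar.
Proof.
by apply: eq_bigr => l _; rewrite mderiv_hypervar -varZ mulr1.
Qed.

Lemma euler_hypervarX k : euler (hypervar ^+ k) = hypervar ^+ k *+ k.
Proof.
elim: k => [|k IH].
  by rewrite /euler big1 // => l _; rewrite expr0 -mpolyC1 mderivC mulr0.
by rewrite exprS eulerM euler_hypervar IH mulrnAr -mulrS.
Qed.

(** In a direction whose unit is [1] the derivative of the variable is
    central, so that the commutative power rule survives. *)
Lemma mderiv_hypervarX l k : e l = 1 ->
  mderiv l (hypervar ^+ k.+1) = hypervar ^+ k *+ k.+1.
Proof.
move=> el; elim: k => [|k IH].
  by rewrite expr1 mderiv_hypervar el scale1r.
rewrite exprS mderivM IH mderiv_hypervar el scale1r mul1r mulrnAr -exprS.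
by rewrite -mulrS.
Qed.

Lemma lapl_homog k p : p \is ishomog1 k.+2 mdeg -> lapl p \is ishomog1 k mdeg.
Proof.
have D d f l : f \is ishomog1 d.+1 mdeg -> mderiv l f \is ishomog1 d mdeg.
  move=> /dhomogP fH; apply/dhomogP => m; rewrite mcoeff_msupp mcoeff_mderiv => H.
  apply: succn_inj; rewrite -addn1 -(mdeg1 l) -mdegD; apply: fH.
  by rewrite mcoeff_msupp; apply: contraNneq H => ->; rewrite mul0rn.
by move=> pH; apply: rpred_sum => l _; apply/D/D.
Qed.

Lemma hypervar_homog k : hypervar ^+ k \is ishomog1 k mdeg.
Proof.
rewrite -[X in ishomog1 X]mul1n; apply: dhomogMn; apply: rpred_sum => l _.
by apply: dhomogZ; rewrite dhomogX; apply/eqP; exact: mdeg1.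
Qed.

Lemma dhomog_msizeE k p : p != 0 -> p \is ishomog1 k mdeg ->
  mmeasure mdeg p = k.+1.
Proof.
move=> p0 pH; rewrite [RHS](congr1 succn (dhomog_uniq p0 pH (dhomog_msize pH))).
by rewrite -(mpolySpred mdeg p0).
Qed.

End PolynomialOperators.

(** * Harmonicity of the derived powers *)

Section HarmonicSequences.
Variables (K : nzRingType).

(** Harmonicity propagates along the recursion: modulo the harmonic terms,
    [Delta (2 x_0 W_(k+1))] contributes [4 (k+1) W_k] and [Delta (N W_k)]
    contributes [8 W_k + 4 E W_k = 4 (k+1) W_k]. The constant [8 = 2 * 4] is where
    dimension four enters. The Euler condition says that [W_k] is homogeneous
    of degree [k - 1], in a form that stays meaningful for [k = 0]. *)
Lemma lapl_recurrence (W : nat -> mpoly 4 K) :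
  lapl (W 0%N) = 0 -> lapl (W 1%N) = 0 ->
  (forall k, W k.+2 = (var K ord0 * W k.+1) *+ 2 - sqnorm 4 K * W k) ->
  (forall k, mderiv ord0 (W k.+1) = W k *+ k.+1) ->
  (forall k, euler (W k) + W k = W k *+ k) ->
  forall k, lapl (W k) = 0.
Proof.
move=> W0 W1 Wrec WD WE k; suff [] : lapl (W k) = 0 /\ lapl (W k.+1) = 0 by [].
elim: k => [//|k [IH0 IH1]]; split=> //.
rewrite Wrec raddfB raddfMn /= lapl_var lapl_sqnorm IH0 IH1 !mulr0 !addr0 WD.
have -> : euler (W k) = W k *+ k - W k by rewrite -WE addrK.
apply/eqP; rewrite subr_eq0 mulrnBl -!mulrnA -[4.*2]/(4 + 4)%N mulrnDr -addrA.
by rewrite [X in _ + X]addrC subrK -mulrnDr -mulSn.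
Qed.

End HarmonicSequences.

Section CliffordPowers.
Variables (n : nat) (K : nzRingType) (e : 'I_n.+1 -> K).
Hypothesis double_eq0 : forall p : mpoly n.+1 K, p *+ 2 = 0 -> p = 0.
Hypothesis cliffordE : forall l m, e l * e m + e m * e l =
  ((l == ord0)%:R * e m + (m == ord0)%:R * e l - (l == m)%:R) *+ 2.

(** In the square of the variable only the symmetrized products of units
    matter; they are paired by summing the square with its transpose, which
    is why the identity is first obtained up to a factor two. *)
Lemma hypervar_sqr :
  hypervar e ^+ 2 = (var K ord0 * hypervar e) *+ 2 - sqnorm n.+1 K.
Proof.
apply/eqP; rewrite -subr_eq0; apply/eqP/double_eq0/eqP; rewrite mulrnBl subr_eq0.
pose t l m := var K l * var K m : mpoly n.+1 K.
have QE : hypervar e ^+ 2 = \sum_l \sum_m (e l * e m) *: t l m.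
  rewrite expr2 {1}/hypervar mulr_suml; apply: eq_bigr => l _.
  rewrite -scalerAl mulr_sumr scaler_sumr; apply: eq_bigr => m _.
  by rewrite -varZ scalerA.
rewrite mulr2n [X in X + _ == _]QE QE.
rewrite [X in _ + X == _]exchange_big -big_split /=.
pose d1 l m : mpoly n.+1 K := (l == ord0)%:R *: (e m *: t l m).
pose d2 l m : mpoly n.+1 K := (m == ord0)%:R *: (e l *: t l m).
pose d3 l m : mpoly n.+1 K := (l == m)%:R *: t l m.
rewrite (eq_bigr (fun l => \sum_m (d1 l m + d2 l m - d3 l m) *+ 2)); last first.
  move=> l _; rewrite -big_split; apply: eq_bigr => m _ /=.
  rewrite -[t m l]varC -/(t l m) -scalerDl cliffordE -scalerMnl scalerBl.
  by rewrite scalerDl -!scalerA.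
have E1 : \sum_l \sum_m d1 l m = var K ord0 * hypervar e.
  rewrite (bigD1 ord0) //= [X in _ + X]big1 ?addr0 => [|l l0].
    by rewrite mulr_sumr; apply: eq_bigr => m _; rewrite /d1 eqxx scale1r varZ.
  by rewrite big1 // => m _; rewrite /d1 (negPf l0) scale0r.
have E2 : \sum_l \sum_m d2 l m = var K ord0 * hypervar e.
  rewrite -E1 exchange_big; apply: eq_bigr => m _; apply: eq_bigr => l _.
  by rewrite /d1 /d2 /t varC.
have E3 : \sum_l \sum_m d3 l m = sqnorm n.+1 K.
  apply: eq_bigr => l _; rewrite (bigD1 l) //= big1 ?addr0 => [|m ml].
    by rewrite /d3 eqxx scale1r expr2.
  by rewrite /d3 eq_sym (negPf ml) scale0r.
have -> : \sum_l \sum_m (d1 l m + d2 l m - d3 l m) *+ 2 =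
  (\sum_l \sum_m d1 l m + \sum_l \sum_m d2 l m - \sum_l \sum_m d3 l m) *+ 2.
  rewrite -big_split -sumrB -sumrMnl; apply: eq_bigr => l _ /=.
  by rewrite -big_split -sumrB -sumrMnl.
by rewrite E1 E2 E3 -mulr2n.
Qed.

Lemma hypervarX_rec k : hypervar e ^+ k.+2 =
  (var K ord0 * hypervar e ^+ k.+1) *+ 2 - sqnorm n.+1 K * hypervar e ^+ k.
Proof.
by rewrite -addn2 addnC exprD hypervar_sqr mulrBl mulrnAl -mulrA -exprS.
Qed.

Hypothesis e0 : e ord0 = 1.

(** The derivative of [2 x_0] leaves [2 x^(k+1)] and that of [|x|^2] leaves
    [2 x x^k]: they cancel, and the recursion of the powers is inherited. *)
Lemma dirac_hypervarX_rec k : dirac_op e (hypervar e ^+ k.+2) =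
  (var K ord0 * dirac_op e (hypervar e ^+ k.+1)) *+ 2
  - sqnorm n.+1 K * dirac_op e (hypervar e ^+ k).
Proof.
rewrite hypervarX_rec raddfB raddfMn /= dirac_var dirac_sqnorm e0 scale1r.
by rewrite mulrnDl -exprS opprD addrACA subrr add0r.
Qed.

End CliffordPowers.

(** Fueter's theorem for powers of the variable. *)
Lemma dirac_lapl_hypervarX (K : nzRingType) (e : 'I_4 -> K) k :
  (forall p : mpoly 4 K, p *+ 2 = 0 -> p = 0) ->
  (forall l m, e l * e m + e m * e l =
     ((l == ord0)%:R * e m + (m == ord0)%:R * e l - (l == m)%:R) *+ 2) ->
  e ord0 = 1 ->
  dirac_op e (lapl (hypervar e ^+ k)) = 0.
Proof.
move=> double_eq0 cliffordE e0; rewrite dirac_lapl.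
have lapl_const c : lapl (mpolyC 4 c) = 0 :> mpoly 4 K.
  by rewrite /lapl big1 // => l _; rewrite mderivC mderiv0.
apply: (@lapl_recurrence _ (fun k => dirac_op e (hypervar e ^+ k))) => [||j|j|j].
- by rewrite expr0 -dirac_lapl -mpolyC1 lapl_const raddf0.
- rewrite expr1 -dirac_lapl [lapl _](_ : _ = 0) ?raddf0 // /lapl big1 // => l _.
  by rewrite mderiv_hypervar -mul_mpolyC mulr1 mderivC.
- exact: dirac_hypervarX_rec.
- by rewrite mderiv_dirac mderiv_hypervarX // raddfMn.
- by rewrite addrC -dirac_euler euler_hypervarX raddfMn.
Qed.

(** * Quaternionic polynomials and the functions they define *)

Section QuaternionicPolynomials.
Variable R : realType.
Implicit Types (q : quat R) (l m : 'I_4) (p : mpoly 4 (quat R)).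

Definition qunit l : quat R := nth 0 [:: 1; qi R; qj R; qk R] l.

(** Distinct imaginary units anticommute and square to [- 1]; the terms with
    index [ord0] account for the real unit. *)
Lemma qunit_clifford l m : qunit l * qunit m + qunit m * qunit l =
  ((l == ord0)%:R * qunit m + (m == ord0)%:R * qunit l - (l == m)%:R) *+ 2.
Proof.
case: l m => [[|[|[|[|l]]]] //= ?] [[|[|[|[|m]]]] //= ?];
  rewrite /qunit /= ?(mul1r, mul0r, mulr1, addr0, add0r, subr0, sub0r,
    addrK, mulr2n, subrr) //;
  apply: quat_eqP; rewrite ?mulr2n ?qcoordE /q0 /q1 /q2 /q3 /=; ring.
Qed.

Lemma mpoly_double_eq0 p : p *+ 2 = 0 -> p = 0.
Proof.
move=> p2; rewrite -[p]scale1r.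
have -> : (1 : quat R) = ((2^-1)%:A : quat R) *+ 2.
  by rewrite scalerMnl -mulr_natr mulVf ?pnatr_eq0// scale1r.
by rewrite -scalerMnl scalerMnr p2 scaler0.
Qed.

Lemma dirac_lapl_qX k : dirac_op qunit (lapl (hypervar qunit ^+ k)) = 0.
Proof.
apply: dirac_lapl_hypervarX => //; [exact: mpoly_double_eq0|].
exact: qunit_clifford.
Qed.

Definition qcoord l q : R := tnth [tuple q0 q; q1 q; q2 q; q3 q] l.
Definition ev p q : quat R := meval (coords q) p.
(** Real polynomials are treated apart: the product rule is only
    needed for monomials, whose values are real. *)
Definition evR (r : mpoly 4 R) q : R := meval (qcoord^~ q) r.

Lemma evD p p' q : ev (p + p') q = ev p q + ev p' q.
Proof. exact: mevalD. Qed.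

Lemma evZ c p q : ev (c *: p) q = c * ev p q.
Proof. exact: mevalZ. Qed.

Lemma ev_monomial (m : multinom 4) q : ev (mpolyX _ m) q = (evR (mpolyX _ m) q)%:A.
Proof.
rewrite /ev /evR !mevalX.
elim/big_rec2: _ => [|l x y _ ->]; first by rewrite scale1r.
by rewrite exprZn expr1n -scalerAl mul1r scalerA.
Qed.

(** Evaluation at noncommuting points is not multiplicative in general; it is
    here because real multiples of [1] are central in the quaternions. *)
Lemma evM p p' q : ev (p * p') q = ev p q * ev p' q.
Proof.
have central (a : R) (x : quat R) : GRing.comm x a%:A.
  by rewrite /GRing.comm mulr_algl mulr_algr.
apply: (commr_mmap_is_multiplicative (h := coords q) (f := idfun) _ _).1.
  by move=> l x; exact: central.
move=> r m m'; have -> : mmap1 (coords q) m' = ev (mpolyX _ m') q.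
  by rewrite /ev mevalX.
by rewrite ev_monomial.
Qed.

Lemma ev_hypervarX k q : ev (hypervar qunit ^+ k) q = q ^+ k.
Proof.
elim: k => [|k IH]; first by rewrite !expr0; exact: meval1.
rewrite !exprS evM IH; congr (_ * _).
rewrite /ev /hypervar !big_ord_recl big_ord0 !mevalD meval0 !mevalZ !mevalXU.
rewrite /coords /qunit /=.
apply: quat_eqP; rewrite !qcoordE /q0 /q1 /q2 /q3 /=; ring.
Qed.

(** The point of this class is that it is multiplicatively closed: monomials
    reduce to the single variables. *)
Definition has_partials (r : mpoly 4 R) : Prop := forall q,
  differentiable (evR r) q /\
  forall l, 'D_(qunit l) (evR r) q = evR (mderiv l r) q.

Lemma has_partialsM (r s : mpoly 4 R) :
  has_partials r -> has_partials s -> has_partials (r * s).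
Proof.
move=> hr hs q; have [dr Dr] := hr q; have [ds Ds] := hs q.
have -> : evR (r * s) = evR r * evR s by apply/funext => x; exact: mevalM.
split; first exact: differentiableM.
move=> l; rewrite deriveM ?Dr ?Ds; [|exact: diff_derivable..].
by rewrite mderivM /evR mevalD !mevalM addrC /GRing.scale /= mulrC.
Qed.

Lemma has_partials1 : has_partials 1.
Proof.
have -> : has_partials 1 = has_partials (mpolyC 4 1) by rewrite mpolyC1.
move=> q; have -> : evR (mpolyC 4 1) = cst 1.
  by apply/funext => x; exact: mevalC.
split; first exact: differentiable_cst.
by move=> l; rewrite derive_cst mderivC /evR meval0.
Qed.

Lemma coord_linear l : linear (qcoord l).
Proof. by case: l => [[|[|[|[|l]]]] Hl]. Qed.
HB.instance Definition _ l :=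
  GRing.isLinear.Build R (quat R) R _ (qcoord l) (coord_linear l).

Lemma coord_continuous l : continuous (qcoord l).
Proof.
have fstc (T U : topologicalType) : continuous (@fst T U).
  by move=> x; exact: cvg_fst.
have sndc (T U : topologicalType) : continuous (@snd T U).
  by move=> x; exact: cvg_snd.
case: l => [[|[|[|[|l]]]] Hl] //= x.
- apply: (@continuous_comp _ _ _ (fst \o fst) fst); last exact: fstc.
  by apply: continuous_comp; exact: fstc.
- apply: (@continuous_comp _ _ _ (fst \o fst) snd); last exact: sndc.
  by apply: continuous_comp; exact: fstc.
- by apply: (@continuous_comp _ _ _ fst snd); [exact: fstc|exact: sndc].
- exact: sndc.
Qed.

Lemma has_partials_var l : has_partials (var R l).
Proof.
move=> q; have -> : evR (var R l) = qcoord l.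
  by apply/funext => x; exact: mevalXU.
have dl : differentiable (qcoord l) q.
  exact/linear_differentiable/coord_continuous.
split=> // m; rewrite deriveE // diff_lin; last exact: coord_continuous.
rewrite mderiv_var -mpolyC_nat /evR mevalC.
by case: l m {dl} => [[|[|[|[|l]]]] //= ?] [[|[|[|[|m]]]] //= ?].
Qed.

Lemma has_partials_monomial (m : multinom 4) : has_partials (mpolyX _ m).
Proof.
rewrite mpolyXE_id; elim/big_ind: _ => [||l _].
- exact: has_partials1.
- exact: has_partialsM.
elim: (m l) => [|k IH]; first exact: has_partials1.
by rewrite exprS; apply: has_partialsM => //; exact: has_partials_var.
Qed.

(** A quaternionic polynomial is a sum of constants scaled by real monomials,
    which reduces the claim to real functions. *)
Lemma ev_derive p q : differentiable (ev p) q /\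
  forall l, 'D_(qunit l) (ev p) q = ev (mderiv l p) q.
Proof.
elim/mpolyind: p => [|c m p _ _ [dp Dp]].
  have -> : ev 0 = cst 0 by apply/funext => x; exact: meval0.
  split; first exact: differentiable_cst.
  by move=> l; rewrite derive_cst mderiv0 /ev meval0.
have [dm Dm] := has_partials_monomial m q.
have -> : ev (c *: mpolyX _ m + p) =
    (fun x => evR (mpolyX _ m) x *: c) + ev p.
  by apply/funext => x; rewrite evD evZ ev_monomial mulr_algr.
have dmc : differentiable (fun x => evR (mpolyX _ m) x *: c) q.
  exact: differentiableZl.
split; first exact: differentiableD.
move=> l; rewrite deriveD ?Dp; [|exact: diff_derivable..].
rewrite deriveE // diffZl // -deriveE // Dm mderivD mderivZ evD evZ.
rewrite !mderivX !evZ ev_monomial /evR mevalZ -scalerA scaler_nat.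
by rewrite mulr_natl mulrnAr mulr_algr.
Qed.
End QuaternionicPolynomials.

(** * Gaussian integrability of polynomials *)

Section GaussianIntegrability.
Variable R : realType.
Local Notation mu := (@lebesgue_measure R).

Definition halfgauss (x : R) : R := expR (- (x ^+ 2 / 2)).

Lemma measurable_halfgauss : measurable_fun [set: measurableTypeR R] halfgauss.
Proof.
apply: measurableT_comp => //; apply: measurableT_comp => //.
by apply: measurable_funM => //; exact: measurable_funX.
Qed.

Lemma integral_halfgauss_lty : (\int[mu]_x (halfgauss x)%:E < +oo)%E.
Proof.
have peak0 : 0 < normal_peak (1 : R) by rewrite normal_peak_gt0 ?oner_neq0.
have halfgaussE (x : R) : halfgauss x = (normal_peak 1)^-1 * normal_pdf 0 1 x.
  rewrite normal_pdfE ?oner_neq0 // mulKf ?gt_eqF // /halfgauss /normal_fun.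
  by rewrite subr0 expr1n mulNr.
under eq_integral do rewrite halfgaussE EFinM.
rewrite integralZl //; last exact: integrable_normal_pdf.
by rewrite integral_normal_pdf mule1 ltry.
Qed.

(** Rectangles built from two exhausting sequences exhaust the product. *)
Lemma sigma_finite_product d (T : measurableType d)
    (m : {measure set T -> \bar R}) :
  sigma_finite [set: T] m -> sigma_finite [set: T * measurableTypeR R] (m \x mu)%E.
Proof.
move=> /sigma_finiteP[F [TF ndF Foo]].
have /sigma_finiteP[G [TG ndG Goo]] := sigma_finiteT mu.
exists (fun n => F n `*` G n)%classic; last first.
  move=> k; have [mF Fy] := Foo k; have [mG Gy] := Goo k.
  split; first exact: measurableX.
  by rewrite product_measure1E// lte_mul_pinfty ?ge0_fin_numE.
apply/esym/seteqP; split=> // -[x y] _ /=.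
have [i _ Fx] : (\bigcup_i F i)%classic x by rewrite -TF.
have [j _ Gy] : (\bigcup_i G i)%classic y by rewrite -TG.
exists (maxn i j) => //; split=> /=.
  by move: Fx; apply/subsetPset/ndF/leq_maxl.
by move: Gy; apply/subsetPset/ndG/leq_maxr.
Qed.

(** Tonelli for a product of functions of separate variables; applied one
    coordinate at a time it handles the Gaussian in any dimension. *)
Lemma integral_tensor_lty d (T : measurableType d)
    (m0 : {measure set T -> \bar R}) (f : T -> R)
    (g : measurableTypeR R -> R) :
  sigma_finite [set: T] m0 ->
  measurable_fun [set: T] f -> measurable_fun [set: measurableTypeR R] g ->
  (forall x, 0 <= f x) -> (forall y, 0 <= g y) ->
  (\int[m0]_x (f x)%:E < +oo)%E -> (\int[mu]_y (g y)%:E < +oo)%E ->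
  (\int[m0 \x mu]_z (f z.1 * g z.2)%:E < +oo)%E.
Proof.
move=> sm.
(* Tonelli needs a bundled sigma-finite structure on the measure m0. *)
pose fM := isSFinite.Build _ _ _ m0 (sfinite_measure_sigma_finite sm).
pose sM := isSigmaFinite.Build _ _ _ m0 sm.
pose m : {sigma_finite_measure set T -> \bar R} := 
  HB.pack (measure_function.Measure.sort m0) fM sM.
rewrite -[measure_function.Measure.sort m0]/(measure_function.Measure.sort m).
move=> mf mg f0 g0 fy gy.
have mfg : measurable_fun [set: T * measurableTypeR R]
    (fun z => (f z.1 * g z.2)%:E).
  by apply/measurable_EFinP/measurable_funM; apply: measurableT_comp.
rewrite fubini_tonelli1 //; last first.
  by move=> z; rewrite lee_fin mulr_ge0.
have If0 : (0 <= \int[m]_x (f x)%:E)%E.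
  by apply: integral_ge0 => x _; rewrite lee_fin.
have Ig0 : (0 <= \int[mu]_y (g y)%:E)%E.
  by apply: integral_ge0 => x _; rewrite lee_fin.
rewrite /fubini_F /=.
under eq_integral => x _.
  under eq_integral do rewrite EFinM.
  rewrite ge0_integralZl //; last 3 first.
  - exact/measurable_EFinP.
  - by move=> y _; rewrite lee_fin.
  - by rewrite lee_fin.
  over.
rewrite ge0_integralZr //; last 2 first.
- exact/measurable_EFinP.
- by move=> y _; rewrite lee_fin.
by rewrite lte_mul_pinfty ?ge0_fin_numE.
Qed.

Local Notation T4 := (measurableTypeR R * measurableTypeR R
  * measurableTypeR R * measurableTypeR R)%type.
Implicit Types (q : quat R) (l : 'I_4).

Definition sqabs q : R := \sum_l qcoord l q ^+ 2.

Lemma sqabsE q : sqabs q = q0 q ^+ 2 + q1 q ^+ 2 + q2 q ^+ 2 + q3 q ^+ 2.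
Proof. by rewrite /sqabs !big_ord_recl big_ord0 addr0 /qcoord /= !addrA. Qed.

Lemma qabs_sqr q : qabs q ^+ 2 = sqabs q.
Proof. by rewrite /qabs sqr_sqrtr -sqabsE // sumr_ge0 // => l _; rewrite sqr_ge0. Qed.

Lemma integral_gauss4_lty :
  (\int[lebesgue4 R]_q (expR (- (sqabs q / 2)))%:E < +oo)%E.
Proof.
have -> : (fun q : T4 => (expR (- (sqabs q / 2)))%:E) = (fun q : T4 =>
    (halfgauss q.1.1.1 * halfgauss q.1.1.2 * halfgauss q.1.2
     * halfgauss q.2)%:E).
  apply/funext => q; rewrite sqabsE /halfgauss -!expRD -!opprD -!mulrDl.
  by [].
have mg := measurable_halfgauss; have g0 x : 0 <= halfgauss x by exact: expR_ge0.
have gy := integral_halfgauss_lty.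
have s1 : sigma_finite [set: measurableTypeR R] mu by exact: sigma_finiteT.
have s2 := sigma_finite_product s1; have s3 := sigma_finite_product s2.
pose g2 (z : measurableTypeR R * measurableTypeR R) : R :=
  halfgauss z.1 * halfgauss z.2.
pose g3 (z : measurableTypeR R * measurableTypeR R * measurableTypeR R) : R :=
  g2 z.1 * halfgauss z.2.
have mg2 : measurable_fun setT g2.
  by apply: measurable_funM; apply: measurableT_comp.
have mg3 : measurable_fun setT g3.
  by apply: measurable_funM; apply: measurableT_comp.
have g20 z : 0 <= g2 z by rewrite mulr_ge0.
have g30 z : 0 <= g3 z by rewrite mulr_ge0.
apply: (integral_tensor_lty (f := g3) s3) => //.
apply: (integral_tensor_lty (f := g2) s2) => //.
exact: (integral_tensor_lty s1).
Qed.

(** Growth slower than every Gaussian, with the rate quantified universally so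
    that the class is closed under products. *)
Definition tame (f : quat R -> R) : Prop :=
  measurable_fun [set: T4] f /\
  forall eps, 0 < eps ->
    exists C, forall q, `|f q| <= C * expR (eps * sqabs q).

Lemma sqabs_ge0 q : 0 <= sqabs q.
Proof. by apply: sumr_ge0 => l _; exact: sqr_ge0. Qed.

Lemma tame_cst a : tame (fun=> a).
Proof.
split; first exact: measurable_cst.
move=> eps e0; exists `|a| => q; rewrite ler_peMr // -[leLHS]expR0 ler_expR.
by rewrite mulr_ge0 ?sqabs_ge0 // ltW.
Qed.

Lemma tame_coord l : tame (qcoord l).
Proof.
split.
  case: l => [[|[|[|[|l]]]] Hl] //=; rewrite /qcoord.
  - exact: (measurableT_comp measurable_fst
      (measurableT_comp measurable_fst measurable_fst)).
  - exact: (measurableT_comp measurable_snd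
      (measurableT_comp measurable_fst measurable_fst)).
  - exact: (measurableT_comp measurable_snd measurable_fst).
  - exact: measurable_snd.
(* The witness comes from |x| <= 1 + x^2 and 1 + eps s <= exp (eps s). *)
move=> eps e0; exists (1 + eps^-1) => q.
have xs : qcoord l q ^+ 2 <= sqabs q.
  by rewrite /sqabs (bigD1 l) //= lerDl sumr_ge0 // => m _; exact: sqr_ge0.
have ie0 : 0 < eps^-1 by rewrite invr_gt0.
apply: (@le_trans _ _ ((1 + eps^-1) * (1 + eps * sqabs q))); last first.
  by rewrite ler_wpM2l ?expR_ge1Dx // addr_ge0 // ltW.
have -> : (1 + eps^-1) * (1 + eps * sqabs q)
    = 1 + eps * sqabs q + eps^-1 + sqabs q.
  by field; rewrite gt_eqF.
have es : 0 <= eps * sqabs q by rewrite mulr_ge0 ?sqabs_ge0 // ltW.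
have : `|qcoord l q| <= 1 + qcoord l q ^+ 2.
  rewrite -real_normK ?num_real //; have := sqr_ge0 (`|qcoord l q| - 1).
  have := normr_ge0 (qcoord l q); nra.
by lra.
Qed.

Lemma tameD f g : tame f -> tame g -> tame (fun q => f q + g q).
Proof.
move=> [mf bf] [mg bg]; split; first exact: measurable_funD.
move=> eps e0; have [C hC] := bf _ e0; have [D hD] := bg _ e0.
exists (C + D) => q; rewrite mulrDl (le_trans (ler_normD _ _)) //.
by rewrite lerD.
Qed.

Lemma tameM f g : tame f -> tame g -> tame (fun q => f q * g q).
Proof.
move=> [mf bf] [mg bg]; split; first exact: measurable_funM.
move=> eps e0; have e2 : 0 < eps / 2 by rewrite divr_gt0.
have [C hC] := bf _ e2; have [D hD] := bg _ e2.
exists (C * D) => q; rewrite normrM [eps]splitr mulrDl expRD mulrACA.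
by rewrite ler_pM.
Qed.

Lemma tame_evR_monomial (m : multinom 4) : tame (evR (mpolyX _ m)).
Proof.
have -> : evR (mpolyX _ m) = fun q => \prod_l qcoord l q ^+ m l.
  by apply/funext => q; exact: mevalX.
elim: (index_enum _) => [|l s IH].
  by under eq_fun do rewrite big_nil; exact: tame_cst.
under eq_fun do rewrite big_cons; apply: tameM => //.
elim: (m l) => [|k IHk]; first exact: tame_cst.
by under eq_fun do rewrite exprS; apply: tameM => //; exact: tame_coord.
Qed.

Lemma tame_coord_ev p l : tame (fun q => qcoord l (ev p q)).
Proof.
elim/mpolyind: p => [|c m p _ _ IH].
  under eq_fun do rewrite /ev meval0 raddf0; exact: tame_cst.
under eq_fun do rewrite evD raddfD evZ ev_monomial mulr_algr /=.
apply: tameD => //; under eq_fun do rewrite linearZ /=.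
by apply: tameM; [exact: tame_evR_monomial | exact: tame_cst].
Qed.

(** Half of the exponent absorbs the growth of the polynomial, the other half
    remains as an integrable Gaussian. *)
Lemma integral_ev_lty p :
  (\int[lebesgue4 R]_q (qabs (ev p q) ^+ 2 * expR (- (qabs q ^+ 2)))%:E
   < +oo)%E.
Proof.
have [mF bF] : tame (fun q => qabs (ev p q) ^+ 2).
  have t l : tame (fun q => qcoord l (ev p q) ^+ 2).
    by under eq_fun do rewrite expr2; apply: tameM; exact: tame_coord_ev.
  under eq_fun do rewrite qabs_sqr /sqabs !big_ord_recl big_ord0.
  by do !apply: tameD => //; exact: tame_cst.
have half_gt0 : 0 < 2^-1 :> R by rewrite invr_gt0.
have [C hC] := bF _ half_gt0.
have C0 : 0 <= C.
  have := hC 0; have := normr_ge0 (qabs (ev p 0) ^+ 2).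
  move=> /le_trans H /H; rewrite pmulr_lge0 //; exact: expR_gt0.
have msq : measurable_fun [set: T4] sqabs.
  have [] // : tame sqabs.
  rewrite /sqabs; under eq_fun do rewrite !big_ord_recl big_ord0.
  do !apply: tameD; try exact: tame_cst;
    by under eq_fun do rewrite expr2; apply: tameM; exact: tame_coord.
apply: (@le_lt_trans _ _
    (\int[lebesgue4 R]_q (C%:E * (expR (- (sqabs q / 2)))%:E))%E).
  apply: ge0_le_integral => //.
  - by move=> q _; rewrite lee_fin mulr_ge0 ?sqr_ge0 ?expR_ge0.
  - apply/measurable_EFinP/measurable_funM => //.
    under eq_fun do rewrite qabs_sqr.
    by apply: measurableT_comp => //; exact: measurableT_comp.
  - apply/measurable_EFinP/measurable_funM => //.
    apply: measurableT_comp => //; apply: measurableT_comp => //.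
    exact: measurable_funM.
  move=> q _; rewrite -EFinM lee_fin (qabs_sqr q).
  apply: (@le_trans _ _ (C * expR (2^-1 * sqabs q) * expR (- sqabs q))).
    by rewrite ler_wpM2r ?expR_ge0 // (le_trans (ler_norm _)).
  by rewrite -mulrA -expRD ler_wpM2l // ler_expR; lra.
rewrite ge0_integralZl //; last first.
- apply/measurable_EFinP.
  apply: measurableT_comp => //; apply: measurableT_comp => //.
  exact: measurable_funM.
rewrite lte_mul_pinfty ?integral_gauss4_lty //.
Qed.

End GaussianIntegrability.

(** * The Appell polynomials *)

Section AppellPolynomials.
Variable R : realType.
Implicit Types (q : quat R) (p : mpoly 4 (quat R)).

Lemma derive_ev l p : 'D_(qunit R l) (ev p) = ev (mderiv l p).
Proof. by apply/funext => q; have [_ ->] := ev_derive p q. Qed.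

Lemma qunitE : qunit R ord0 = 1 /\ qunit R (inord 1) = qi R /\
  qunit R (inord 2) = qj R /\ qunit R (inord 3) = qk R.
Proof. by rewrite /qunit !inordK. Qed.

Lemma big_ord4 (V : nmodType) (F : 'I_4 -> V) :
  \sum_l F l = F ord0 + F (inord 1) + F (inord 2) + F (inord 3).
Proof.
rewrite !big_ord_recl big_ord0 addr0 !addrA.
by congr (F _ + F _ + F _ + F _); apply/val_inj; rewrite /= ?inordK.
Qed.

Lemma laplacian_ev p q : laplacian (ev p) q = ev (lapl p) q.
Proof.
have [e0 [e1 [e2 e3]]] := qunitE.
by rewrite /lapl big_ord4 !evD -!derive_ev e0 e1 e2 e3.
Qed.

Lemma cauchy_fueter_ev p q : cauchy_fueter (ev p) q = ev (dirac_op (qunit R) p) q.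
Proof.
have [e0 [e1 [e2 e3]]] := qunitE.
by rewrite /dirac_op big_ord4 !evD !evZ -!derive_ev e0 e1 e2 e3 mul1r.
Qed.

(** On Fueter regular functions the conjugate operator is thus twice the
    derivative in the real direction. *)
Lemma cauchy_fueter_conjE (f : quat R -> quat R) q :
  cauchy_fueter_conj f q = (2 : R) *: 'D_1 f q - cauchy_fueter f q.
Proof.
by rewrite scaler_nat /cauchy_fueter_conj /cauchy_fueter mulr2n !opprD !addrA
  addrK. Qed.

Definition appell_mpoly k : mpoly 4 (quat R) :=
  ((k.+2)`!%:R^-1 : R)%:A *: lapl (hypervar (qunit R) ^+ k.+2).

Lemma fueter_appell_ev k : fueter_appell R k = ev (appell_mpoly k).
Proof.
apply/funext => q; rewrite evZ mulr_algl /fueter_appell.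
have -> : (fun x : quat R => x ^+ k.+2) = ev (hypervar (qunit R) ^+ k.+2).
  by apply/funext => x; rewrite ev_hypervarX.
by rewrite laplacian_ev.
Qed.

Lemma mderiv_appell k : mderiv ord0 (appell_mpoly k.+1) = appell_mpoly k.
Proof.
have [e0 _] := qunitE.
rewrite /appell_mpoly mderivZ mderiv_lapl (mderiv_hypervarX k.+2 e0) raddfMn.
rewrite -scalerMnr scalerMnl; congr (_ *: _).
rewrite scalerMnl; congr (_ *: _).
by rewrite factS natrM invfM -mulr_natr mulrAC mulVf ?mul1r // pnatr_eq0.
Qed.

Lemma dirac_appell k : dirac_op (qunit R) (appell_mpoly k) = 0.
Proof.
rewrite /appell_mpoly dirac_opZ ?dirac_lapl_qX ?scaler0 // => l.
by rewrite /GRing.comm mulr_algl mulr_algr.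
Qed.

(** Since [P_k] is the derivative of [P_(k+1)] in the real direction, it is
    enough that [P_0], which is [- 4 / 2!], is nonzero. *)
Lemma appell_neq0 k : appell_mpoly k != 0.
Proof.
elim: k => [|k]; last by apply: contraNneq => H; rewrite -mderiv_appell H mderiv0.
rewrite /appell_mpoly.
have [e0 [e1 [e2 e3]]] := qunitE.
have -> : lapl (hypervar (qunit R) ^+ 2) = mpolyC 4 (- 4 : R)%:A.
  rewrite /lapl (eq_bigr (fun l => mpolyC 4 (qunit R l * qunit R l *+ 2))).
    rewrite -raddf_sum big_ord4 e0 e1 e2 e3; congr mpolyC.
    by apply: quat_eqP; rewrite !mulr2n !qcoordE /q0 /q1 /q2 /q3 /=; ring.
  move=> l _; rewrite expr2 mderivM mderivD !mderivM !mderiv_hypervar.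
  rewrite -!mul_mpolyC !mulr1 !mderivC.
  by rewrite mul0r mulr0 add0r addr0 -mpolyCM -mpolyCD mulr2n.
rewrite -mul_mpolyC -mpolyCM mpolyC_eq0 mulr_algl !scaler_eq0 oner_eq0.
by rewrite invr_eq0 oppr_eq0 !pnatr_eq0.
Qed.

Lemma appell_homog k : appell_mpoly k \is ishomog1 k mdeg.
Proof. by apply/dhomogZ/lapl_homog/hypervar_homog. Qed.

Lemma fueter_regular_appell k : fueter_regular (fueter_appell R k).
Proof.
rewrite fueter_appell_ev; split=> q; first by have [] := ev_derive (appell_mpoly k) q.
by rewrite cauchy_fueter_ev dirac_appell /ev meval0.
Qed.

End AppellPolynomials.

Theorem theorem3p8 (R : realType) :
  (forall k : nat,
     spherical_monogenic k (fueter_appell R k) /\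
     regular_Bargmann (fueter_appell R k)) /\
  appell_set (fueter_appell R).
Proof.
split=> [k|[//|k] q _].
  have reg := fueter_regular_appell R k.
  split; split=> //.
    exists (appell_mpoly R k); split; last by move=> q; rewrite fueter_appell_ev.
    by apply: dhomog_msizeE; [exact: appell_neq0 | exact: appell_homog].
  rewrite fueter_appell_ev lte_mul_pinfty ?integral_ev_lty //.
  by rewrite lee_fin invr_ge0 exprn_ge0 ?pi_ge0.
have [_ regk] := fueter_regular_appell R k.+1.
have [e0 _] := qunitE R.
rewrite cauchy_fueter_conjE regk subr0 /= !fueter_appell_ev.
have -> : 'D_1 (ev (appell_mpoly R k.+1)) q = ev (appell_mpoly R k) q.
  by rewrite -e0 (ev_derive _ q).2 mderiv_appell.
by rewrite scalerA mulVf ?scale1r // pnatr_eq0.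
Qed.
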